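(* Let $S(A,B,C,D\,|\,x,y;v)$ denote the weights defined in the context. For any integers $a,b\in[0,n]$ and $x,y,v\in\mathbb{C}$, $$\sum_{0\le c,d\le n}S(a,b,c,d\,|\,x,y;v)=1 .$$ Furthermore, for any fixed $x,y,z,v\in\mathbb{C}$ and integers $i_1,j_1,k_1,i_3,j_3,k_3\in[0,n]$, $$\begin{aligned} \sum_{0\le i_2,j_2,k_2\le n}& S\big(i_1,j_1,i_2,j_2\,|\,x,y;q^{1-\mathbf{1}_{k_1=0}}v\big)\,S\big(k_1,j_2,k_2,j_3\,|\,x,z;v\big)\,S\big(k_2,i_2,k_3,i_3\,|\,y,z;q^{1-\mathbf{1}_{j_3=0}}v\big)\\ =\sum_{0\le i_2,j_2,k_2\le n}& S\big(k_1,i_1,k_2,i_2\,|\,y,z;v\big)\,S\big(k_2,j_1,k_3,j_2\,|\,x,z;q^{1-\mathbf{1}_{i_2=0}}v\big)\,S\big(i_2,j_2,i_3,j_3\,|\,x,y;v\big). \end{aligned}$$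
   Context: Let $n$ be a positive integer and $q,v,x,y$ complex numbers. Here $\mathbf{1}_E$ is $1$ if $E$ holds and $0$ otherwise. For every integer $i\in[1,n]$ define $$\begin{aligned} S(i,0,0,i\,|\,x,y;v)&=\frac{(1-q)x(1-qvy)}{(x-qy)(1-qvx)}, & S(i,0,i,0\,|\,x,y;v)&=\frac{q(x-y)(1-vx)}{(x-qy)(1-qvx)},\\ S(0,i,0,i\,|\,x,y;v)&=\frac{(x-y)(1-qvy)}{(x-qy)(1-vy)}, & S(0,i,i,0\,|\,x,y;v)&=\frac{(1-q)y(1-vx)}{(x-qy)(1-vy)}, \end{aligned}$$ for every pair of integers $1\le i<j\le n$ define $$\begin{aligned} S(i,j,j,i\,|\,x,y;v)&=\frac{(1-q)x}{x-qy}, & S(j,i,i,j\,|\,x,y;v)&=\frac{(1-q)y}{x-qy},\\ S(i,j,i,j\,|\,x,y;v)&=\frac{q(x-y)}{x-qy}, & S(j,i,j,i\,|\,x,y;v)&=\frac{x-y}{x-qy}, \end{aligned}$$ and set $S(j,j,j,j\,|\,x,y;v)=1$ for every $j\in[0,n]$ and $S(A,B,C,D\,|\,x,y;v)=0$ for all other quadruples $(A,B,C,D)\in\{0,1,\dots,n\}^4$. Parameters are assumed to be such that all denominators appearing are nonzero. *)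

(* Defs.v *)
From mathcomp Require Import all_boot all_order all_algebra.
From mathcomp Require Import reals complex.

Set Implicit Arguments.
Unset Strict Implicit.
Unset Printing Implicit Defensive.

Import Order.TTheory GRing.Theory Num.Theory.

Local Open Scope ring_scope.
Local Open Scope complex_scope.

(* Colours [0, n] are 'I_n.+1, with 0 playing a special role.  The guards
   below are pairwise disjoint, so their order is immaterial. *)
Definition Swt (R : realType) (n : nat) (q : R[i])
    (A B C D : 'I_n.+1) (x y v : R[i]) : R[i] :=
  if [&& (0 < A)%N, B == ord0, C == ord0 & D == A] then
    (1 - q) * x * (1 - q * v * y) / ((x - q * y) * (1 - q * v * x))
  else if [&& (0 < A)%N, B == ord0, C == A & D == ord0] then
    q * (x - y) * (1 - v * x) / ((x - q * y) * (1 - q * v * x))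
  else if [&& A == ord0, (0 < B)%N, C == ord0 & D == B] then
    (x - y) * (1 - q * v * y) / ((x - q * y) * (1 - v * y))
  else if [&& A == ord0, (0 < B)%N, C == B & D == ord0] then
    (1 - q) * y * (1 - v * x) / ((x - q * y) * (1 - v * y))
  else if [&& (0 < A)%N, (A < B)%N, C == B & D == A] then
    (1 - q) * x / (x - q * y)
  else if [&& (0 < B)%N, (B < A)%N, C == B & D == A] then
    (1 - q) * y / (x - q * y)
  else if [&& (0 < A)%N, (A < B)%N, C == A & D == B] then
    q * (x - y) / (x - q * y)
  else if [&& (0 < B)%N, (B < A)%N, C == A & D == B] then
    (x - y) / (x - q * y)
  else if [&& A == B, B == C & C == D] then 1
  else 0.

(* The denominators occurring in the weights at (x, y; v) do not vanish
   (division by zero is total in the library, so this must be assumed). *)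
Definition Sdef (R : realType) (q x y v : R[i]) : Prop :=
  [/\ x - q * y != 0, 1 - q * v * x != 0 & 1 - v * y != 0].

(* The dynamical parameter q ^ (1 - 1_{k = 0}) v; the exponent is 0 or 1. *)
Definition qshift (R : realType) (n : nat) (q : R[i]) (k : 'I_n.+1)
    (v : R[i]) : R[i] :=
  q ^+ (1 - (k == ord0))%N * v.

(* Main.v *)
(* For a <> b the only transitions are (a, b) -> (a, b) and (a, b) -> (b, a),
   and their weights sum to 1.  With t the weight of the second, S therefore
   acts on functions of pairs of colours by F |-> F a b + t (F b a - F a b),
   whatever t is when a = b.  The Yang-Baxter equation becomes an identity
   between compositions of such operators, in which only the six permutations
   of (i1, j1, k1) occur; for each relative order of i1, j1, k1 and 0 it is an
   identity of rational functions. *)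
Require Import Defs.
From mathcomp Require Import all_boot all_order all_algebra.
From mathcomp Require Import reals complex.
From mathcomp Require Import ring zify.

Import Order.TTheory GRing.Theory Num.Theory.
Local Open Scope ring_scope.
Local Open Scope complex_scope.

Set Implicit Arguments.
Unset Strict Implicit.

Section Exchange.
Variables (K : fieldType) (n : nat) (q : K).
Implicit Types (a b : 'I_n.+1) (x y z v : K).

(* The weight of (a, b) -> (b, a); junk for a = b. *)
Definition exch a b x y v : K :=
  if b == ord0 then
    (1 - q) * x * (1 - q * v * y) / ((x - q * y) * (1 - q * v * x))
  else if a == ord0 then
    (1 - q) * y * (1 - v * x) / ((x - q * y) * (1 - v * y))
  else if (a <= b)%N then (1 - q) * x / (x - q * y)
  else (1 - q) * y / (x - q * y).

Definition exch_op x y v (F : 'I_n.+1 -> 'I_n.+1 -> K) a b : K :=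
  F a b + exch a b x y v * (F b a - F a b).

Lemma eq_exch_op x y v F G a b :
  F =2 G -> exch_op x y v F a b = exch_op x y v G a b.
Proof. by move=> FG; rewrite /exch_op !FG. Qed.

Lemma exch_op0 x y v F a b :
  (forall c d, F c d = 0) -> exch_op x y v F a b = 0.
Proof. by move=> F0; rewrite /exch_op !F0 subrr mulr0 addr0. Qed.

(** The counterpart of [qshift] over an arbitrary field; over [R[i]] both unfold to the same
    term. *)
Definition dynshift a v := q ^+ (1 - (a == ord0))%N * v.

(* F k3 j3 i3 is the value at the outgoing colours.  The left-hand side can
   contain the denominator 1 - q^2 v y, which the right-hand side does not, but
   only in front of values with j3 != 0; hence the last hypothesis. *)
Lemma exch_op_yang_baxter x y z v (F : 'I_n.+1 -> 'I_n.+1 -> 'I_n.+1 -> K)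
    (i j k : 'I_n.+1) :
  x - q * y != 0 -> x - q * z != 0 -> y - q * z != 0 ->
  1 - v * y != 0 -> 1 - v * z != 0 ->
  1 - q * v * x != 0 -> 1 - q * v * y != 0 -> 1 - q * v * z != 0 ->
  1 - q * (q * v) * x != 0 ->
  (1 - q * (q * v) * y = 0 -> forall a b c, b != ord0 -> F a b c = 0) ->
  exch_op x y (dynshift k v) (fun i2 j2 =>
    exch_op x z v (fun k2 j3 =>
      exch_op y z (dynshift j3 v) (fun k3 i3 => F k3 j3 i3) k2 i2) k j2) i j
  = exch_op y z v (fun k2 i2 =>
      exch_op x z (dynshift i2 v) (fun k3 j2 =>
        exch_op x y v (fun i3 j3 => F k3 j3 i3) i2 j2) k2 j) k i.
Proof.
move=> xy xz yz vy vz vx1 vy1 vz1 vx2 HF; rewrite /exch_op /exch /dynshift.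
(* If the exceptional denominator vanishes, [HF] kills every value it stands in front of; otherwise
   it joins the nonzero denominators given to [field]. *)
have [w0|w] := eqVneq (1 - q * (q * v) * y) 0;
  [move: HF => /(_ w0) HF | clear HF].
all: have [i0|i0] := eqVneq i ord0; have [j0|j0] := eqVneq j ord0;
  have [k0|k0] := eqVneq k ord0.
all: rewrite ?(i0, j0, k0) ?eqxx.
all: do ?rewrite (negPf i0); do ?rewrite (negPf j0); do ?rewrite (negPf k0).
all: rewrite /= ?subnn ?expr0 ?subn0 ?expr1 ?mul1r.
all: try do ?rewrite (HF _ _ _ i0); try do ?rewrite (HF _ _ _ j0);
  try do ?rewrite (HF _ _ _ k0).
all: rewrite ?(subrr, mulr0, addr0, subr0, sub0r) //.
all: try subst i; try subst j; try subst k.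
(* Only nonzero colours are still variables here. Their relative order selects the weights; [lia]
   discards the inconsistent orders. *)
all: try case: (ltngtP i j) => [ij|ij|/val_inj ij]; try subst j.
all: try case: (ltngtP i k) => [ik|ik|/val_inj ik]; try subst k.
all: try case: (ltngtP j k) => [jk|jk|/val_inj jk]; try subst k.
all: try (exfalso; clear - ij ik jk; lia).
all: try (exfalso; clear - ij ik; lia).
all: rewrite ?leqnn ?ltnn; try rewrite (ltnW ij); try rewrite leqNgt ij /=.
all: by field; rewrite ?xy ?xz ?yz ?vy ?vz ?vx1 ?vy1 ?vz1 ?vx2 ?w.
Qed.

End Exchange.

Lemma sum_delta2 (K : pzRingType) (I J : finType) (F : I -> J -> K) a b :
  \sum_c \sum_d ((c == a) && (d == b))%:R * F c d = F a b.
Proof.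
rewrite (bigD1 a) //= (bigD1 b) //= !eqxx mul1r !big1 ?addr0 //.
- by move=> c /negPf ca; rewrite big1 // => d _; rewrite ca mul0r.
- by move=> d /negPf db; rewrite db andbF mul0r.
Qed.

Section Weights.
Variables (R : realType) (n : nat) (q : R[i]).
Implicit Types (a b c d : 'I_n.+1) (x y v : R[i]).

(** For [a = b] the two indicators coincide and the coefficients add up to 1. For [a != b] each
    diagonal weight is 1 minus the exchange weight, as in (x - qy)(1 - qvx) - (1 - q)x(1 - qvy) =
    q(x - y)(1 - vx). *)
Lemma SwtE a b c d x y v : Sdef q x y v ->
  Swt q a b c d x y v =
  (1 - exch q a b x y v) * ((c == a) && (d == b))%:R
  + exch q a b x y v * ((c == b) && (d == a))%:R.
Proof.
case=> xy vx vy; rewrite /Swt.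
have pos (e : 'I_n.+1) : (0 < e)%N = (e != ord0) by rewrite -val_eqE lt0n.
rewrite !pos; have [<-|ab] := eqVneq a b.
  rewrite ltnn -mulrDl subrK mul1r.
  have -> : [&& true, a == c & c == d] = (c == a) && (d == a).
    by rewrite (eq_sym a); have [->|] := eqVneq c a; rewrite // eq_sym.
  by have [a0|a0] := eqVneq a ord0; rewrite ?andbF /=; case: ifP.
have swap2 (P Q : R[i]) :
    P * ((c == a) && (d == b))%:R + Q * ((c == b) && (d == a))%:R
    = if (c == a) && (d == b) then P
      else if (c == b) && (d == a) then Q else 0.
  case: ifP => [/andP[/eqP-> /eqP->]|_].
    by rewrite (negPf ab) mulr0 mulr1 addr0.
  by rewrite mulr0 add0r; case: ifP => _; rewrite ?mulr0 ?mulr1.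
(* Some branches of [Swt] test the exchange first; since [a != b], the two guards are disjoint and
   may be permuted. *)
have swap2' (P Q : R[i]) :
    (if (c == b) && (d == a) then Q else if (c == a) && (d == b) then P else 0)
    = if (c == a) && (d == b) then P
      else if (c == b) && (d == a) then Q else 0.
  by case: ifP => [/andP[/eqP-> /eqP->]|//]; rewrite eq_sym (negPf ab).
rewrite swap2 /exch.
have [a0|a0] := eqVneq a ord0.
  subst a; rewrite (eq_sym b) (negPf ab) /=.
  by congr (if _ then _ else _); field; rewrite xy vy.
have [b0|b0] := eqVneq b ord0.
  subst b; rewrite /= swap2'.
  by congr (if _ then _ else _); field; rewrite xy vx.
case: (ltngtP a b) ab => [ab _|ab _|/val_inj ->]; last by rewrite eqxx.
  by rewrite /= swap2'; congr (if _ then _ else _); field.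
by rewrite /= swap2'; congr (if _ then _ else _); field.
Qed.

Lemma sum_Swt x y v (F : 'I_n.+1 -> 'I_n.+1 -> R[i]) a b : Sdef q x y v ->
  \sum_c \sum_d Swt q a b c d x y v * F c d = exch_op q x y v F a b.
Proof.
move=> D.
under eq_bigr => c _ do under eq_bigr => d _ do
  rewrite SwtE // mulrDl -!mulrA.
under eq_bigr => c _ do rewrite big_split -!mulr_sumr.
by rewrite big_split -!mulr_sumr !sum_delta2 /exch_op /=; ring.
Qed.

(** Serves for the last factor on each side of the Yang-Baxter equation, whose outgoing colours are
    fixed rather than summed. *)
Lemma Swt_delta x y v a b c d : Sdef q x y v ->
  Swt q a b c d x y v =
  exch_op q x y v (fun c' d' => ((c' == c) && (d' == d))%:R) a b.
Proof.
move=> D; rewrite -sum_Swt //.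
under eq_bigr => ? _ do under eq_bigr => ? _ do rewrite mulrC.
by rewrite sum_delta2.
Qed.

End Weights.

Unset Implicit Arguments.
Set Strict Implicit.

Theorem theorem1p4 (R : realType) (n : nat) (hn : (0 < n)%N) (q : R[i]) :
  (forall (a b : 'I_n.+1) (x y v : R[i]),
     Sdef q x y v ->
     \sum_(c < n.+1) \sum_(d < n.+1) Swt q a b c d x y v = 1)
  /\
  (forall (x y z v : R[i]) (i1 j1 k1 i3 j3 k3 : 'I_n.+1),
     Sdef q x y (qshift q k1 v) ->
     Sdef q x z v ->
     Sdef q y z (qshift q j3 v) ->
     Sdef q y z v ->
     (forall i2 : 'I_n.+1, Sdef q x z (qshift q i2 v)) ->
     Sdef q x y v ->
     \sum_(i2 < n.+1) \sum_(j2 < n.+1) \sum_(k2 < n.+1)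
        Swt q i1 j1 i2 j2 x y (qshift q k1 v)
        * Swt q k1 j2 k2 j3 x z v
        * Swt q k2 i2 k3 i3 y z (qshift q j3 v)
     = \sum_(i2 < n.+1) \sum_(j2 < n.+1) \sum_(k2 < n.+1)
        Swt q k1 i1 k2 i2 y z v
        * Swt q k2 j1 k3 j2 x z (qshift q i2 v)
        * Swt q i2 j2 i3 j3 x y v).
Proof.
split=> [a b x y v D|x y z v i1 j1 k1 i3 j3 k3 Dxyk Dxz Dyzj Dyz Dxzi Dxy].
  have /= := sum_Swt (fun _ _ => 1) a b D.
  under eq_bigr => c _ do under eq_bigr => d _ do rewrite mulr1.
  by move=> ->; rewrite /exch_op subrr mulr0 addr0.
pose F k' j' i' : R[i] := ((k' == k3) && (j' == j3) && (i' == i3))%:R.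
transitivity (exch_op q x y (dynshift q k1 v) (fun i2 j2 =>
    exch_op q x z v (fun k2 d =>
      exch_op q y z (dynshift q d v) (fun c e => F c d e) k2 i2) k1 j2) i1 j1).
  rewrite -sum_Swt //; apply: eq_bigr => i2 _; apply: eq_bigr => j2 _.
  rewrite -sum_Swt // mulr_sumr; apply: eq_bigr => k2 _.
  (* The operator also sums over the outgoing colour [d]; as [F] vanishes off [d = j3], only the
     term of the theorem survives. *)
  rewrite (bigD1 j3) //= big1 => [|d /negPf dj3]; last first.
    by rewrite exch_op0 ?mulr0 // => c e; rewrite /F dj3 andbF.
  rewrite addr0 (Swt_delta k2) // !mulrA; congr (_ * _).
  by apply: eq_exch_op => c e; rewrite /F eqxx andbT.
have [xy vx1 vy] := Dxy; have [xz _ vz] := Dxz; have [yz vy1 _] := Dyz.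
(* Since [n > 0], the colour [ord_max] is nonzero, so its shift is exactly [q * v]. *)
have [_ vx2 vz1] : Sdef q x z (q * v).
  by have := Dxzi ord_max; rewrite /qshift -val_eqE /= (gtn_eqF hn) subn0 expr1.
rewrite exch_op_yang_baxter //; last first.
(* A nonzero value of [F] forces [d = j3], hence [j3 != 0], and then [Dyzj] excludes the vanishing
   of this denominator. *)
- move=> w c d e d0; rewrite /F; have [dj3|] := eqVneq d j3; last by rewrite andbF.
  have [_ + _] := Dyzj.
  by rewrite /qshift -dj3 (negPf d0) subn0 expr1 w eqxx.
rewrite -sum_Swt // exchange_big /=; apply: eq_bigr => i2 _.
rewrite [RHS]exchange_big /=; apply: eq_bigr => k2 _.
rewrite -sum_Swt; last exact: Dxzi.
(* On this side the colour [k3] is already final after the second crossing, so the sum over [c]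
   collapses. *)
rewrite (bigD1 k3) //= [X in _ + X]big1 => [|c /negPf ck3]; last first.
  rewrite big1 // => j2 _.
  by rewrite exch_op0 ?mulr0 // => e d; rewrite /F ck3.
rewrite addr0 mulr_sumr; apply: eq_bigr => j2 _.
rewrite (Swt_delta i2) // !mulrA; congr (_ * _).
by apply: eq_exch_op => e d; rewrite /F eqxx andTb andbC.
Qed.
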